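(* Let $K$ be a field of characteristic $p>0$ and $s\ge1$. For $u=(u_{ik})\in\mathcal{M}_{n,s}$ define elements of $\mathcal{D}_n$: $y_{u,i}^{[0]}=1$, $y_{u,i}^{[1]}=\partial_i^{[p^s]}+u_{i0}$, recursively for $k\ge1$ $y_{u,i}^{[p^k]}=u_{ik}+\int_i^{*p^s}\prod_{l=0}^{k-1}\frac{(y_{u,i}^{[p^l]})^{p-1}}{(p-1)!}$, for $j=\sum_kj_kp^k$ ($0\le j_k<p$) $y_{u,i}^{[j]}=\prod_k\frac{(y_{u,i}^{[p^k]})^{j_k}}{j_k!}$, and $y_u^{[\alpha]}=\prod_{i=1}^ny_{u,i}^{[\alpha_i]}$ for $\alpha\in\mathbb{N}^n$. Then the map $u\mapsto y_u=\{y_u^{[\alpha]}\}_{\alpha\in\mathbb{N}^n}$ is a bijection from $\mathcal{M}_{n,s}$ onto the set $\mathrm{ID}(\delta^{p^s},\mathcal{D}_n)$, and its inverse sends $z=\{z^{[\alpha]}\}$ to $u=(u_{ik})$ with $u_{ik}=z_i^{[p^k]}-\int_i^{*p^s}z_i^{[p^k-1]}$, where $z_i^{[j]}:=z^{[je_i]}$.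
   Context: $P_n=K[x_1,\ldots,x_n]$; $\partial_i^{[k]}=\partial_i^k/k!$, $\partial^{[\alpha]}=\prod_i\partial_i^{[\alpha_i]}$; $\mathcal{D}_n=\bigoplus_{\alpha\in\mathbb{N}^n}K\partial^{[\alpha]}$ is the commutative algebra of scalar differential operators, with $\partial^{[\alpha]}\partial^{[\beta]}=\binom{\alpha+\beta}{\beta}\partial^{[\alpha+\beta]}$. Let $\delta_i=-\mathrm{ad}(x_i)$ (inner derivation of the ring of differential operators $\mathcal{D}(P_n)$); on $\mathcal{D}_n$, $\delta_i(\partial^{[\alpha]})=\partial^{[\alpha-e_i]}$ (zero if $\alpha_i=0$), so $\delta_i^{p^s}$ maps $\mathcal{D}_n$ to itself; $\delta^{p^s}=(\delta_1^{p^s},\ldots,\delta_n^{p^s})$. $\mathrm{ID}(\delta^{p^s},\mathcal{D}_n)$ is the set of families $\{y^{[\alpha]}\}_{\alpha\in\mathbb{N}^n}\subseteq\mathcal{D}_n$ with $y^{[0]}=1$, $y^{[\alpha]}y^{[\beta]}=\binom{\alpha+\beta}{\beta}y^{[\alpha+\beta]}$ and $\prod_i(\delta_i^{p^s})^{\alpha_i}(y^{[\beta]})=y^{[\beta-\alpha]}$ for all $\alpha,\beta$ ($y^{[\gamma]}=0$ if $\gamma\notin\mathbb{N}^n$). The dual integration $\int_i^*:\mathcal{D}_n\to\mathcal{D}_n$ is the $K$-linear map $\partial^{[\alpha]}\mapsto\partial^{[\alpha+e_i]}$, and $\int_i^{*p^s}$ is its $p^s$-th power. $C_s^n=\{\alpha\in\mathbb{N}^n\mid\alpha_i<p^s\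 \forall i\}$. $\mathcal{M}_{n,s}$ is the set of matrices $u=(u_{ik})$, $i=1,\ldots,n$, $k\in\mathbb{N}$, with all $u_{ik}\in\bigoplus_{0\neq\alpha\in C_s^n}K\partial^{[\alpha]}$. *)

(* Defs.v *)
From mathcomp Require Import all_boot all_order all_algebra.
Set Implicit Arguments. Unset Strict Implicit. Unset Printing Implicit Defensive.
Import GRing.Theory.
Local Open Scope ring_scope.

Section DivPow.
Variables (K : fieldType) (n : nat).

Definition mi := {ffun 'I_n -> nat}.
Definition mi0 : mi := [ffun=> 0%N].
Definition miadd (a b : mi) : mi := [ffun j => (a j + b j)%N].
Definition misub (a b : mi) : mi := [ffun j => (a j - b j)%N].  (* truncated *)
Definition mile (a b : mi) : bool := [forall j, (a j <= b j)%N].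
Definition mie (i : 'I_n) (m : nat) : mi := [ffun j => if j == i then m else 0%N].
Definition mibin (a b : mi) : nat := \prod_(j < n) 'C(a j, b j).

(* Coefficient functions: f represents sum_alpha f(alpha) d^[alpha]. *)
Definition Dfun := mi -> K.
(* membership in D_n = (+)_alpha K d^[alpha]: finite support *)
Definition inD (f : Dfun) : Prop :=
  exists N : nat, forall a : mi, f a != 0 -> forall j, (a j < N)%N.

Definition dbasis (a : mi) : Dfun := fun b => (b == a)%:R.
Definition done : Dfun := dbasis mi0.
Definition dadd (f g : Dfun) : Dfun := fun a => f a + g a.
Definition dsub (f g : Dfun) : Dfun := fun a => f a - g a.
Definition dscale (c : K) (f : Dfun) : Dfun := fun a => c * f a.
(* product determined by d^[a] d^[b] = binom(a+b, b) d^[a+b] *)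
Definition dmul (f g : Dfun) : Dfun := fun a =>
  \sum_(b : {ffun 'I_n -> 'I_((\max_(j < n) a j)%N).+1}
          | [forall j, (b j <= a j)%N])
     (mibin a [ffun j => (b j : nat)])%:R
       * f [ffun j => (b j : nat)] * g [ffun j => (a j - b j)%N].
Definition dpow (f : Dfun) (m : nat) : Dfun := iter m (dmul f) done.
Definition ddivpow (f : Dfun) (m : nat) : Dfun := dscale (m`!)%:R^-1 (dpow f m).

(* dual integration  int_i^* : d^[a] |-> d^[a + e_i] *)
Definition dint (i : 'I_n) (f : Dfun) : Dfun := fun a =>
  if (0 < a i)%N then f (misub a (mie i 1)) else 0.
(* delta_i = -ad(x_i) on D_n : d^[a] |-> d^[a - e_i] (0 if a_i = 0) *)
Definition ddelta (i : 'I_n) (f : Dfun) : Dfun := fun a => f (miadd a (mie i 1)).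

Definition ddeltaP (q : nat) (a : mi) (f : Dfun) : Dfun :=
  foldr (fun i g => iter (a i) (iter q (ddelta i)) g) f (enum 'I_n).

Definition inID (p s : nat) (y : mi -> Dfun) : Prop :=
  [/\ forall a, inD (y a),
      y mi0 = done,
      forall a b, dmul (y a) (y b) = dscale (mibin (miadd a b) b)%:R (y (miadd a b))
    & forall a b, ddeltaP (p ^ s) a (y b) =
                  if mile a b then y (misub b a) else (fun _ => 0)].

Definition inMns (p s : nat) (u : 'I_n -> nat -> Dfun) : Prop :=
  forall i k, inD (u i k) /\
    forall a, u i k a != 0 -> a != mi0 /\ forall j, (a j < p ^ s)%N.

(* y_{u,i}^{[p^k]} together with prod_{l=0}^{k} (y^{[p^l]})^{p-1}/(p-1)! *)
Fixpoint yP (p s : nat) (u : 'I_n -> nat -> Dfun) (i : 'I_n) (k : nat)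
    : Dfun * Dfun :=
  match k with
  | 0 => let y0 := dadd (dbasis (mie i (p ^ s))) (u i 0%N) in
         (y0, ddivpow y0 p.-1)
  | k'.+1 => let P := (yP p s u i k').2 in
             let y := dadd (u i k) (iter (p ^ s) (dint i) P) in
             (y, dmul P (ddivpow y p.-1))
  end.
Definition ypk p s u i k : Dfun := (yP p s u i k).1.

Definition yj p s u (i : 'I_n) (j : nat) : Dfun :=
  \big[dmul/done]_(k < j.+1) ddivpow (ypk p s u i k) ((j %/ p ^ k) %% p).
Definition yu p s u (a : mi) : Dfun := \big[dmul/done]_(i < n) yj p s u i (a i).

Definition uz (p s : nat) (z : mi -> Dfun) : 'I_n -> nat -> Dfun := fun i k =>
  dsub (z (mie i (p ^ k))) (iter (p ^ s) (dint i) (z (mie i (p ^ k).-1))).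

End DivPow.

(* Main.v *)
Require Import Defs.
From HB Require Import structures.
From mathcomp Require Import all_boot all_order all_algebra.
From mathcomp Require Import boolp.
Set Implicit Arguments. Unset Strict Implicit. Unset Printing Implicit Defensive.
Import GRing.Theory.
Local Open Scope ring_scope.

(** Write [q = p ^ s]. In characteristic [p] the [delta_i^q] are derivations, whose common kernel
    is the span of the [d^[a]] with all [a_j < q]; and an element without constant term has zero
    p-th power, since p-th powers are killed by every [delta_j], hence constant.
    By Lucas' theorem a divided power sequence [z^[j]] is the product over the base-p digits of
    [j] of divided powers of its members [z^[p^k]], and conversely any elements [y_k] with
    [y_k^p = 0] are the [y^[p^k]] of such a sequence. The conditions on the [delta_i^q] then
    reduce to [delta_i^q (y_k) = y^[p^k - 1]] and [delta_j^q (y_k) = 0] for [j != i]. This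
    determines [y_k] up to the common kernel: [int_i^q y^[p^k - 1]] is a particular solution,
    [u_ik] is the free parameter, and it has no constant term because [y_k] is nilpotent. *)

(** * Binomial coefficients and factorials in characteristic p *)

Section Lucas.
Variables (R : nzRingType) (p : nat).
Hypothesis pcharRp : p \in [pchar R].

Let p_pr : prime p := pcharf_prime pcharRp.
Let p_gt0 : (0 < p)%N := prime_gt0 p_pr.

Lemma natr_bin_pchar_eq0 k : (0 < k < p)%N -> 'C(p, k)%:R = 0 :> R.
Proof. by move=> /(prime_dvd_bin p_pr); rewrite (dvdn_pcharf pcharRp) => /eqP. Qed.

Lemma natr_bin_pcharD m k :
  'C(p + m, k)%:R = 'C(m, k)%:R + (if (p <= k)%N then 'C(m, k - p) else 0%N)%:R :> R.
Proof.
rewrite -binomial.Vandermonde natr_sum big_ord_recl /= bin0 mul1n subn0; congr (_ + _).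
under eq_bigr => i _ do rewrite /bump /= add1n natrM.
case: leqP => [le_pk|lt_kp]; last first.
  by rewrite big1 // => i _; rewrite natr_bin_pchar_eq0 ?mul0r //= (leq_ltn_trans _ lt_kp).
have lt_p1k : (p.-1 < k)%N by rewrite prednK.
rewrite (bigD1 (Ordinal lt_p1k)) //= prednK // binn mul1r big1 ?addr0 // => i.
rewrite -val_eqE /= => neq_i; case: (ltngtP i.+1 p) => [lt_ip|gt_ip|eq_ip].
- by rewrite natr_bin_pchar_eq0 // mul0r.
- by rewrite bin_small // mul0r.
- by rewrite -eq_ip eqxx in neq_i.
Qed.

Lemma natr_bin_Lucas a b r t : (r < p)%N -> (t < p)%N ->
  'C(a * p + r, b * p + t)%:R = ('C(a, b) * 'C(r, t))%:R :> R.
Proof.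
move=> lt_rp lt_tp; elim: a b => [|a IHa] [|b].
- by rewrite bin0 mul1n.
- by rewrite bin0n mul0n add0n bin_small // mulSn -addnA (leq_trans lt_rp) ?leq_addr.
- rewrite mulSn -addnA natr_bin_pcharD mul0n add0n leqNgt lt_tp addr0 -[t in LHS]add0n.
  by rewrite -[X in (X + t)%N](mul0n p) IHa !bin0.
- rewrite !(mulSn, =^~ addnA) natr_bin_pcharD leq_addr addKn -natrD.
  by rewrite addnA -mulSn natrD !IHa -natrD -mulnDl -binS.
Qed.

Lemma natr_pchar_neq0 m : (0 < m < p)%N -> m%:R != 0 :> R.
Proof. by case/andP=> m_gt0 lt_mp; rewrite -(dvdn_pcharf pcharRp) gtnNdvd. Qed.

End Lucas.

Lemma natr_fact_neq0 (F : idomainType) p m : p \in [pchar F] -> (m < p)%N -> (m`!)%:R != 0 :> F.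
Proof.
move=> pcharFp; elim: m => [|m IHm] lt_mp; first by rewrite oner_neq0.
by rewrite factS natrM mulf_neq0 ?IHm ?(ltnW lt_mp) ?(natr_pchar_neq0 pcharFp).
Qed.

(** * Derivations *)

Section IterMorphism.
Variables (U : zmodType) (f : {additive U -> U}) (m : nat).

Fact iter_is_zmod_morphism : zmod_morphism (iter m f).
Proof. by elim: m => [//|k IHk] x y; rewrite !iterS IHk raddfB. Qed.

HB.instance Definition _ := GRing.isZmodMorphism.Build U U (iter m f) iter_is_zmod_morphism.

End IterMorphism.

Section IterScalable.
Variables (R : pzRingType) (U : lmodType R) (f : {linear U -> U}) (m : nat).

Fact iter_is_scalable : scalable (iter m f).
Proof. by elim: m => [//|k IHk] c x; rewrite !iterS IHk linearZ. Qed.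

HB.instance Definition _ := GRing.isScalable.Build R U U *:%R (iter m f) iter_is_scalable.

End IterScalable.

Definition derivation (A : pzRingType) (D : A -> A) : Prop :=
  forall x y, D (x * y) = D x * y + x * D y.

Section Derivation.
Variables (A : pzRingType) (D : {additive A -> A}).
Hypothesis derD : derivation D.

Lemma derivation1 : D 1 = 0.
Proof. by apply: (addrI (D 1)); rewrite addr0 -{3}[1]mulr1 derD mulr1 mul1r. Qed.

Lemma derivation_prod_eq0 I (r : seq I) (P : pred I) (F : I -> A) :
  (forall i, P i -> D (F i) = 0) -> D (\prod_(i <- r | P i) F i) = 0.
Proof.
move=> DF; apply: (big_ind (fun x => D x = 0)) => [|x y Dx Dy|//]; first exact: derivation1.
by rewrite derD Dx Dy mul0r mulr0 addr0.
Qed.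

Lemma derivation_iterM m x y :
  iter m D (x * y) = \sum_(k < m.+1) iter k D x * iter (m - k) D y *+ 'C(m, k).
Proof.
elim: m => [|m IHm]; first by rewrite big_ord1.
rewrite iterS IHm raddf_sum /=.
under eq_bigr => k _ do rewrite raddfMn derD mulrnDl.
rewrite big_split /= [RHS]big_ord_recl bin0 /=.
rewrite [X in _ + X = _]big_ord_recl /= bin0 subn0 addrCA; congr (_ + _).
under [RHS]eq_bigr => k _ do rewrite /bump /= add1n binS mulrnDr subSS.
rewrite big_split /= addrC [X in _ = X + _]big_ord_recr /= bin_small // mulr0n addr0.
by congr (_ + _); apply: eq_bigr => k _; rewrite -[D (iter (m - _) D y)]iterS subnSK.
Qed.

End Derivation.

Section DerivationPchar.
Variables (A : nzRingType) (p : nat).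
Hypothesis pcharAp : p \in [pchar A].

Lemma derivation_iter_pchar (D : {additive A -> A}) : derivation D -> derivation (iter p D).
Proof.
move=> derD x y; rewrite derivation_iterM // big_ord_recr /= subnn binn mulr1n.
rewrite -(big_mkord xpredT (fun k => iter k D x * iter (p - k) D y *+ 'C(p, k))).
rewrite big_ltn ?prime_gt0 ?(pcharf_prime pcharAp) //= bin0 mulr1n subn0.
rewrite big_nat_cond big1 ?addr0 1?addrC // => k; rewrite andbT => lt_k.
by rewrite -mulr_natr (natr_bin_pchar_eq0 pcharAp) ?mulr0.
Qed.

Lemma derivation_iter_pexp (D : {additive A -> A}) s : derivation D -> derivation (iter (p ^ s) D).
Proof.
move=> derD; elim: s => [//|s IHs] x y.
by rewrite expnS !iterM (derivation_iter_pchar IHs).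
Qed.

End DerivationPchar.

Lemma derivationX (A : comPzRingType) (D : {additive A -> A}) x m :
  derivation D -> D (x ^+ m.+1) = x ^+ m * D x *+ m.+1.
Proof.
move=> derD; elim: m => [|m IHm]; first by rewrite mul1r.
by rewrite exprS derD IHm mulrnAr mulrA -exprS [D x * _]mulrC -mulrS.
Qed.

(** * Divided powers *)

Section DivPow.
Variables (K : fieldType) (A : comAlgType K).
Implicit Types (x : A) (D : {linear A -> A}).

Definition divpow m x : A := (m`!)%:R^-1 *: x ^+ m.

Lemma divpow0 x : divpow 0 x = 1.
Proof. by rewrite /divpow invr1 scale1r. Qed.

Lemma divpow1 x : divpow 1 x = x.
Proof. by rewrite /divpow invr1 scale1r. Qed.

Lemma divpowM x r t : ((r + t)`!)%:R != 0 :> K ->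
  divpow r x * divpow t x = 'C(r + t, t)%:R *: divpow (r + t) x.
Proof.
rewrite /divpow -scalerAl -scalerAr !scalerA -exprD -(bin_fact (leq_addl r t)) addnK !natrM.
rewrite mulf_eq0 negb_or => /andP[bin_neq0 _]; congr (_ *: _).
by rewrite invfM mulVKf // invfM mulrC.
Qed.

Lemma divpowM_eq0 x m r t : x ^+ m = 0 -> (m <= r + t)%N -> divpow r x * divpow t x = 0.
Proof.
move=> xm0 le_m; rewrite /divpow -scalerAl -scalerAr -exprD -(subnK le_m) exprD xm0.
by rewrite mulr0 !scaler0.
Qed.

Lemma derivation_divpow D x m : derivation D -> m.+1%:R != 0 :> K ->
  D (divpow m.+1 x) = divpow m x * D x.
Proof.
move=> derD m1_neq0; rewrite /divpow linearZ /= derivationX // -scaler_nat scalerA -scalerAl.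
by congr (_ *: _); rewrite factS natrM invfM mulrAC mulVf ?mul1r.
Qed.

Lemma derivation_divpow_eq0 D x m : derivation D -> D x = 0 -> D (divpow m x) = 0.
Proof.
move=> derD Dx; rewrite /divpow linearZ /=; case: m => [|m].
  by rewrite derivation1 // scaler0.
by rewrite derivationX //= Dx mulr0 mul0rn scaler0.
Qed.

Definition divpow_seq (Z : nat -> A) : Prop :=
  Z 0%N = 1 /\ forall i j, Z i * Z j = 'C(i + j, j)%:R *: Z (i + j)%N.

Lemma divpow_seqX (Z : nat -> A) r : divpow_seq Z -> Z 1%N ^+ r = (r`!)%:R *: Z r.
Proof.
case=> Z0 ZM; elim: r => [|r IHr]; first by rewrite Z0 scale1r.
by rewrite exprSr IHr -scalerAl ZM addn1 bin1 scalerA -natrM mulnC -factS.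
Qed.

Lemma divpow_seq_divpow (Z : nat -> A) r : divpow_seq Z -> (r`!)%:R != 0 :> K ->
  divpow r (Z 1%N) = Z r.
Proof. by move=> Zseq fact_neq0; rewrite /divpow divpow_seqX // scalerA mulVf // scale1r. Qed.

End DivPow.

Lemma predn_mul a m : (0 < a)%N -> (0 < m)%N -> (a * m).-1 = (a.-1 * m + m.-1)%N.
Proof. by case: a m => [|a] [|m] // _ _; rewrite mulSnr addnS. Qed.

Lemma digit_ind p (p_gt1 : (1 < p)%N) (P : nat -> Prop) :
  P 0%N -> (forall a r, (r < p)%N -> P a -> P (a * p + r)%N) -> forall j, P j.
Proof.
move=> P0 PD; elim/ltn_ind => -[|j] IHj //.
rewrite (divn_eq j.+1 p); apply: PD; first by rewrite ltn_pmod // ltnW.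
by apply: IHj; rewrite ltn_Pdiv.
Qed.

Section DigitDivPow.
Variables (K : fieldType) (A : comAlgType K) (p : nat).
Implicit Types y : nat -> A.

(* The member of exponent [j] of the divided power sequence whose members of exponents [p ^ k]
   are the [y k]; the base-p digits of [j] of rank [k > j] vanish. *)
Definition digit_divpow y j : A := \prod_(k < j.+1) divpow ((j %/ p ^ k) %% p) (y k).

Lemma eq_digit_divpow y1 y2 : y1 =1 y2 -> digit_divpow y1 =1 digit_divpow y2.
Proof. by move=> eq_y j; apply: eq_bigr => k _; rewrite eq_y. Qed.

Hypothesis p_gt1 : (1 < p)%N.

Let p_gt0 : (0 < p)%N := ltnW p_gt1.

Lemma digit_divpowE y j N : (j < p ^ N)%N ->
  digit_divpow y j = \prod_(k < N) divpow ((j %/ p ^ k) %% p) (y k).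
Proof.
pose F k := divpow ((j %/ p ^ k) %% p) (y k).
have widen M : (j < p ^ M)%N -> forall d, \prod_(k < M + d) F k = \prod_(k < M) F k.
  move=> lt_j; elim=> [|d IHd]; first by rewrite addn0.
  rewrite addnS big_ord_recr /= IHd /F divn_small ?mod0n ?divpow0 ?mulr1 //.
  by rewrite (leq_trans lt_j) // leq_pexp2l // leq_addr.
have lt_jp : (j < p ^ j.+1)%N by rewrite ltnW // ltn_expl.
by move=> lt_jN; rewrite -[RHS](widen _ lt_jN j.+1) addnC widen.
Qed.

Lemma digit_divpow0 y : digit_divpow y 0 = 1.
Proof. by rewrite (@digit_divpowE _ _ 0) ?big_ord0. Qed.

Lemma digit_divpowMD y a r : (r < p)%N ->
  digit_divpow y (a * p + r) = divpow r (y 0%N) * digit_divpow (y \o succn) a.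
Proof.
move=> lt_rp; have div_a : ((a * p + r) %/ p = a)%N by rewrite divnMDl // divn_small // addn0.
rewrite (@digit_divpowE _ _ a.+2); last by rewrite expnSr -ltn_divLR // div_a ltnW // ltn_expl.
rewrite big_ord_recl expn0 divn1 modnMDl modn_small //; congr (_ * _).
by apply: eq_bigr => k _; rewrite /= /bump /= add1n expnS divnMA div_a.
Qed.

Lemma digit_divpow_pexp y k : digit_divpow y (p ^ k) = y k.
Proof.
elim: k y => [|k IHk] y; last first.
  by rewrite expnSr -[(_ * p)%N]addn0 digit_divpowMD // divpow0 mul1r IHk.
by have := digit_divpowMD y 0 p_gt1; rewrite mul0n add0n digit_divpow0 divpow1 mulr1.
Qed.

Lemma digit_divpow_predn y k : digit_divpow y (p ^ k).-1 = \prod_(l < k) divpow p.-1 (y l).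
Proof.
elim: k y => [|k IHk] y; first by rewrite big_ord0 digit_divpow0.
rewrite expnSr predn_mul ?expn_gt0 ?p_gt0 // digit_divpowMD ?prednK //.
by rewrite IHk big_ord_recl.
Qed.

End DigitDivPow.

Section DigitDivPowPchar.
Variables (K : fieldType) (A : comAlgType K) (p : nat).
Hypothesis pcharKp : p \in [pchar K].
Implicit Types (y Z : nat -> A) (w : A).

Let p_pr : prime p := pcharf_prime pcharKp.
Let p_gt0 : (0 < p)%N := prime_gt0 p_pr.
Let p_gt1 : (1 < p)%N := prime_gt1 p_pr.

Lemma digit_divpow_seq y : (forall k, y k ^+ p = 0) -> divpow_seq (digit_divpow p y).
Proof.
move=> yp0; split=> [|i]; first exact: digit_divpow0.
elim/(digit_ind p_gt1): i y yp0 => [|a r lt_rp IHa] y yp0 j.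
  by rewrite digit_divpow0 // mul1r add0n binn scale1r.
rewrite (divn_eq j p); move: (j %/ p)%N (j %% p)%N (ltn_pmod j p_gt0) => b t lt_tp.
rewrite !digit_divpowMD // addnACA -mulnDl mulrACA IHa => [|k]; last exact: yp0.
have [lt_rtp|le_prt] := ltnP (r + t) p.
  rewrite divpowM ?(natr_fact_neq0 pcharKp) // natr_bin_Lucas // digit_divpowMD //.
  by rewrite -scalerAl -scalerAr scalerA -natrM mulnC.
have -> : ((a + b) * p + (r + t) = (a + b).+1 * p + (r + t - p))%N.
  by rewrite mulSnr -addnA subnKC.
have lt_carry_t : (r + t - p < t)%N by rewrite ltn_subLR // ltn_add2r.
rewrite (divpowM_eq0 (yp0 0%N) le_prt) mul0r natr_bin_Lucas ?(ltn_trans lt_carry_t) //.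
by rewrite (bin_small lt_carry_t) muln0 scale0r.
Qed.

(* The factor [w] makes the statement stable under dropping [y 0]: the shifted sequence
   satisfies the same hypothesis with [w * divpow p.-1 (y 0)]. *)
Lemma derivation_digit_divpow (D : {linear A -> A}) y w j :
  derivation D -> (forall k, y k ^+ p = 0) ->
  (forall k, D (y k) = w * digit_divpow p y (p ^ k).-1) ->
  D (digit_divpow p y j) = if (0 < j)%N then w * digit_divpow p y j.-1 else 0.
Proof.
move=> derD; elim/(digit_ind p_gt1): j y w => [|a r lt_rp IHa] y w yp0 Dy.
  by rewrite digit_divpow0 // derivation1.
have Dy0 : D (y 0%N) = w by rewrite Dy expn0 digit_divpow0 // mulr1.
have Dtail k :
    D (y k.+1) = w * divpow p.-1 (y 0%N) * digit_divpow p (y \o succn) (p ^ k).-1.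
  by rewrite Dy expnSr predn_mul ?expn_gt0 ?p_gt0 // digit_divpowMD ?prednK // mulrA.
rewrite digit_divpowMD // derD (IHa (y \o succn) _ (fun k => yp0 k.+1) Dtail).
case: r lt_rp => [|r] lt_rp.
  rewrite divpow0 derivation1 // mul0r add0r mul1r addn0 muln_gt0 p_gt0 andbT.
  case: ifP => // a_gt0.
  by rewrite predn_mul // digit_divpowMD ?prednK // mulrA.
rewrite addnS /= (digit_divpowMD p_gt1 _ _ (ltnW lt_rp)) derivation_divpow //; last first.
  exact: (natr_pchar_neq0 pcharKp).
have first_digit_vanish : divpow r.+1 (y 0%N) * divpow p.-1 (y 0%N) = 0.
  by rewrite (divpowM_eq0 (yp0 0%N)) // addSnnS prednK // leq_addl.
rewrite Dy0 [X in _ + X](_ : _ = 0) ?addr0; first by rewrite mulrA [w * _]mulrC.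
by case: ifP => _; rewrite ?mulr0 // mulrA mulrCA first_digit_vanish !(mulr0, mul0r).
Qed.

Lemma divpow_seq_dilate Z : divpow_seq Z -> divpow_seq (fun j => Z (j * p)%N).
Proof.
case=> Z0 ZM; split=> [|i j]; first by rewrite mul0n.
have := natr_bin_Lucas pcharKp (i + j) j p_gt0 p_gt0; rewrite !addn0 bin0 muln1 => <-.
by rewrite ZM mulnDl.
Qed.

Lemma digit_divpowK Z : divpow_seq Z -> digit_divpow p (fun k => Z (p ^ k)%N) =1 Z.
Proof.
move=> Zseq j; elim/(digit_ind p_gt1): j Z Zseq => [|a r lt_rp IHa] Z Zseq.
  by rewrite digit_divpow0 //; case: Zseq.
rewrite digit_divpowMD // divpow_seq_divpow ?(natr_fact_neq0 pcharKp) //.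
rewrite (@eq_digit_divpow _ _ _ _ (fun k => Z (p ^ k * p)%N)) => [|k]; last by rewrite /= expnSr.
rewrite (IHa _ (divpow_seq_dilate Zseq)) mulrC; case: Zseq => _ ->.
have := natr_bin_Lucas pcharKp a 0 lt_rp lt_rp; rewrite mul0n add0n bin0 binn => ->.
by rewrite scale1r.
Qed.

Lemma divpow_seq_pexp_nilp Z k : divpow_seq Z -> Z (p ^ k)%N ^+ p = 0.
Proof.
elim: k Z => [|k IHk] Z Zseq; last by rewrite expnSr (IHk _ (divpow_seq_dilate Zseq)).
rewrite divpow_seqX //; have /eqP-> : (p`!)%:R == 0 :> K.
  by rewrite -(dvdn_pcharf pcharKp) dvdn_fact ?p_gt0 /=.
by rewrite scale0r.
Qed.

End DigitDivPowPchar.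

(** * Multi-indices *)

Section MultiIndex.
Variable n : nat.
Implicit Types (a b c : mi n) (i j : 'I_n).

Lemma mi0E j : mi0 n j = 0%N. Proof. by rewrite ffunE. Qed.
Lemma miaddE a b j : miadd a b j = (a j + b j)%N. Proof. by rewrite ffunE. Qed.
Lemma misubE a b j : misub a b j = (a j - b j)%N. Proof. by rewrite ffunE. Qed.
Lemma mieE i m j : mie i m j = if j == i then m else 0%N. Proof. by rewrite ffunE. Qed.

Definition miE := (mi0E, miaddE, misubE, mieE).

Lemma miaddA : associative (@miadd n).
Proof. by move=> a b c; apply/ffunP => j; rewrite !miE addnA. Qed.

Lemma miaddC : commutative (@miadd n).
Proof. by move=> a b; apply/ffunP => j; rewrite !miE addnC. Qed.

Lemma miadd0 a : miadd a (mi0 n) = a.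
Proof. by apply/ffunP => j; rewrite !miE addn0. Qed.

Lemma misub0 a : misub a (mi0 n) = a.
Proof. by apply/ffunP => j; rewrite !miE subn0. Qed.

Lemma miaddK a b : misub (miadd a b) b = a.
Proof. by apply/ffunP => j; rewrite !miE addnK. Qed.

Lemma misubK a b : mile b a -> miadd (misub a b) b = a.
Proof. by move=> /forallP le_ba; apply/ffunP => j; rewrite !miE subnK. Qed.

Lemma misubDA a b c : misub a (miadd b c) = misub (misub a b) c.
Proof. by apply/ffunP => j; rewrite !miE subnDA. Qed.

Lemma misubDr a b c : misub (miadd a c) (miadd b c) = misub a b.
Proof. by apply/ffunP => j; rewrite !miE subnDr. Qed.

Lemma miadd_subAC a b c : mile b a -> misub (miadd a c) b = miadd (misub a b) c.
Proof. by move=> /forallP le_ba; apply/ffunP => j; rewrite !miE addnBAC. Qed.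

Lemma mie0 i : mie i 0 = mi0 n.
Proof. by apply/ffunP => j; rewrite !miE if_same. Qed.

Lemma mie_add i r t : miadd (mie i r) (mie i t) = mie i (r + t).
Proof. by apply/ffunP => j; rewrite !miE; case: eqP. Qed.

Lemma mie_sub i r t : misub (mie i r) (mie i t) = mie i (r - t).
Proof. by apply/ffunP => j; rewrite !miE; case: eqP. Qed.

Lemma mile0 a : mile (mi0 n) a.
Proof. by apply/forallP => j; rewrite miE. Qed.

Lemma mile_mie i m a : mile (mie i m) a = (m <= a i)%N.
Proof.
apply/forallP/idP => [/(_ i)|le_m j]; rewrite miE ?eqxx //.
by case: eqP => [->|].
Qed.

Lemma mile_sub_mie a b i : (0 < b i)%N -> mile a (misub b (mie i 1)) = mile (miadd a (mie i 1)) b.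
Proof.
move=> b_gt0; apply: eq_forallb => j; rewrite !miE.
by case: eqP => [->|_]; rewrite ?subn0 ?addn0 // addn1 subn1 -ltnS prednK.
Qed.

Lemma mi_ind (P : mi n -> Prop) :
  P (mi0 n) -> (forall a i, P a -> P (miadd a (mie i 1))) -> forall a, P a.
Proof.
move=> P0 PS a; have [m] := ubnP (\sum_j a j); elim: m a => // m IHm a lt_am.
have [/forallP a0|/forallPn[i]] := boolP [forall j, a j == 0%N].
  by rewrite (_ : a = mi0 n) //; apply/ffunP => j; rewrite miE; apply/eqP.
rewrite -lt0n => ai_gt0; rewrite -(@misubK a (mie i 1)) ?mile_mie //; apply/PS/IHm.
rewrite -ltnS (leq_trans _ lt_am) // ltnS [ltnLHS](bigD1 i) //= [ltnRHS](bigD1 i) //=.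
rewrite -addSn leq_add ?leq_sum // => [|j _]; last by rewrite misubE leq_subr.
by rewrite !miE eqxx subn1 prednK.
Qed.

Lemma mibin_eq0 a b j : (a j < b j)%N -> mibin a b = 0%N.
Proof. by move=> lt_ab; rewrite /mibin (bigD1 j) //= bin_small. Qed.

Lemma mibinn0 a : mibin a (mi0 n) = 1%N.
Proof. by rewrite /mibin big1 // => j _; rewrite miE bin0. Qed.

Lemma mibin_mie i r t : mibin (mie i r) (mie i t) = 'C(r, t).
Proof.
rewrite /mibin (bigD1 i) //= !miE eqxx big1 ?muln1 // => j /negPf neq_ji.
by rewrite !miE neq_ji.
Qed.

Lemma mibin_addS a b i : mibin (miadd a (mie i 1)) b =
  (mibin a b + if 0 < b i then mibin a (misub b (mie i 1)) else 0)%N.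
Proof.
rewrite /mibin (bigD1 i) //= [X in (_ = X + _)%N](bigD1 i) //= miaddE mieE eqxx addn1.
rewrite (eq_bigr (fun j => 'C(a j, b j))) => [|j /negPf neq_ji]; last first.
  by rewrite !miE neq_ji addn0.
case eq_bi: (b i) => [|m] /=; first by rewrite !bin0 addn0.
rewrite binS mulnDl; congr (_ + _)%N; rewrite [RHS](bigD1 i) //= !miE eqxx eq_bi subn1.
by congr (_ * _)%N; apply: eq_bigr => j /negPf neq_ji; rewrite !miE neq_ji subn0.
Qed.

End MultiIndex.

Section DivPowFamily.
Variables (K : fieldType) (A : comAlgType K) (n : nat).

Definition divpow_family (z : mi n -> A) : Prop :=
  z (mi0 n) = 1 /\ forall a b, z a * z b = (mibin (miadd a b) b)%:R *: z (miadd a b).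

Lemma divpow_family_prod (Z : 'I_n -> nat -> A) :
  (forall i, divpow_seq (Z i)) -> divpow_family (fun a => \prod_i Z i (a i)).
Proof.
move=> Zseq; split=> [|a b].
  by rewrite big1 // => i _; rewrite miE; case: (Zseq i).
rewrite -big_split /= /mibin natr_prod -scaler_prod; apply: eq_bigr => i _.
by rewrite miE; case: (Zseq i) => _ ->.
Qed.

Lemma divpow_family_mie (z : mi n -> A) i :
  divpow_family z -> divpow_seq (fun m => z (mie i m)).
Proof.
case=> z0 zM; split=> [|r t]; first by rewrite mie0.
by rewrite zM mie_add mibin_mie.
Qed.

Lemma divpow_familyE (z : mi n -> A) a :
  divpow_family z -> z a = \prod_i z (mie i (a i)).
Proof.
case=> z0 zM.
have prod_seq (r : seq 'I_n) : uniq r ->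
    \prod_(i <- r) z (mie i (a i)) = z [ffun j => if j \in r then a j else 0%N].
  elim: r => [_|i r IHr /= /andP[/negPf notin_r uniq_r]].
    by rewrite big_nil -z0; congr z; apply/ffunP => j; rewrite !ffunE.
  rewrite big_cons IHr // zM; set b := [ffun j => _].
  have -> : mibin (miadd (mie i (a i)) b) b = 1%N.
    rewrite /mibin big1 // => j _; rewrite !ffunE.
    by case: eqP => [->|_]; rewrite ?notin_r ?bin0 // add0n binn.
  rewrite scale1r; congr z; apply/ffunP => j; rewrite !ffunE in_cons.
  by case: eqP => [->|_]; rewrite ?notin_r ?addn0.
rewrite prod_seq ?index_enum_uniq //; congr z; apply/ffunP => j.
by rewrite ffunE mem_index_enum.
Qed.

End DivPowFamily.

Section Box.
Variable n : nat.
Local Notation box N := {ffun 'I_n -> 'I_N.+1}.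
Implicit Types (a : mi n) (i : 'I_n).

Definition mi_of N (b : {ffun 'I_n -> 'I_N}) : mi n := [ffun j => (b j : nat)].

Lemma mi_ofE N (b : {ffun 'I_n -> 'I_N}) j : mi_of b j = b j.
Proof. by rewrite ffunE. Qed.

Lemma sum_box_widen (V : nmodType) M N (F : mi n -> V) :
  (M <= N)%N -> (forall a i, (M < a i)%N -> F a = 0) ->
  \sum_(b : box N) F (mi_of b) = \sum_(b : box M) F (mi_of b).
Proof.
move=> le_MN F0; pose up (b : box M) : box N :=
  [ffun j => widen_ord (le_MN : (M.+1 <= N.+1)%N) (b j)].
pose down (b : box N) : box M := [ffun j => inord (b j)].
rewrite (bigID (fun b : box N => [forall j, b j <= M]%N)) /=.
rewrite [X in _ + X]big1 ?addr0 => [|b /forallPn[j]]; last first.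
  by rewrite -ltnNge => lt_Mb; apply: (F0 _ j); rewrite mi_ofE.
rewrite (reindex_onto up down) /= => [|b /forallP le_bM]; last first.
  by apply/ffunP => j; apply: val_inj; rewrite !ffunE /= inordK ?ltnS.
apply: eq_big => [b|b _]; last by congr F; apply/ffunP => j; rewrite !ffunE.
rewrite (_ : down (up b) = b) ?eqxx ?andbT.
  by apply/forallP => j; rewrite ffunE /= -ltnS.
by apply/ffunP => j; apply: val_inj; rewrite !ffunE /= inordK.
Qed.

(* The cyclic shift of the [i]-th index wraps around only at index [N], where [F] vanishes. *)
Lemma sum_box_shift (V : nmodType) N (F : mi n -> V) i :
  (forall a, (N <= a i)%N -> F a = 0) ->
  \sum_(b : box N) (if (0 < b i)%N then F (misub (mi_of b) (mie i 1)) else 0) =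
  \sum_(b : box N) F (mi_of b).
Proof.
move=> F0; pose shift (s : 'I_N.+1 -> 'I_N.+1) (b : box N) : box N :=
  [ffun j => if j == i then s (b j) else b j].
have shift_bij : bijective (shift (@ordS N.+1)).
  exists (shift (@ord_pred N.+1)) => b; apply/ffunP => j; rewrite !ffunE.
    by case: eqP => // _; apply: ordSK.
  by case: eqP => // _; apply: ord_predK.
rewrite (reindex (shift (@ordS N.+1))) /=; last exact: onW_bij.
apply: eq_bigr => b _; rewrite ffunE eqxx /=; have [lt_bN|le_Nb] := ltnP (b i) N.
  rewrite modn_small //=; congr F; apply/ffunP => j; rewrite !ffunE.
  by case: eqP => [->|_]; rewrite ?subn0 //= modn_small // subn1.
have -> : b i = N :> nat by apply/eqP; rewrite eqn_leq le_Nb -ltnS ltn_ord.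
by rewrite modnn /= F0 // mi_ofE.
Qed.

End Box.

(** * The divided power algebra *)

Section Product.
Variables (K : fieldType) (n : nat).
Local Notation box N := {ffun 'I_n -> 'I_N.+1}.
Implicit Types (f g h : Dfun K n) (a b : mi n).

Lemma dmulE N f g a : (forall j, a j <= N)%N -> dmul f g a =
  \sum_(b : box N) (mibin a (mi_of b))%:R * f (mi_of b) * g (misub a (mi_of b)).
Proof.
move=> le_aN; pose F b := (mibin a b)%:R * f b * g (misub a b).
have F0 b j : (a j < b j)%N -> F b = 0 by rewrite /F => /mibin_eq0->; rewrite !mul0r.
rewrite (@sum_box_widen _ _ (\max_(j < n) a j) N F); first last.
- by move=> b j lt_b; apply: (F0 b j); apply: leq_ltn_trans lt_b; apply: (leq_bigmax j).
- exact/bigmax_leqP.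
rewrite /dmul big_mkcond /=; apply: eq_bigr => b _; case: forallP => [_|/forallP/forallPn[j]].
  by congr (_ * g _); apply/ffunP => j; rewrite !ffunE.
by rewrite -ltnNge => lt_ab; rewrite (F0 _ j) ?mi_ofE.
Qed.

Lemma dmul_mi0 f g : dmul f g (mi0 n) = f (mi0 n) * g (mi0 n).
Proof.
rewrite (@dmulE 0) => [|j]; last by rewrite miE.
rewrite (big_pred1 [ffun=> ord0]) => [|b]; last first.
  by apply/esym/eqP/ffunP => j; rewrite ffunE [b j]ord1.
have -> : mi_of [ffun=> ord0 : 'I_1] = mi0 n by apply/ffunP => j; rewrite !ffunE.
by rewrite misub0 mibinn0 mul1r.
Qed.

Lemma ddelta_dmul i f g :
  ddelta i (dmul f g) = dadd (dmul (ddelta i f) g) (dmul f (ddelta i g)).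
Proof.
apply/funext => a; pose N := (\max_(j < n) a j).+1%N.
have lt_aN j : (a j < N)%N by rewrite ltnS (leq_bigmax j).
have le_aN j : (a j <= N)%N by apply: ltnW.
have le_aiN j : (miadd a (mie i 1) j <= N)%N.
  by rewrite !miE; case: eqP => _; rewrite ?addn0 ?addn1.
rewrite /dadd {1}/ddelta (dmulE _ _ le_aiN) !(dmulE _ _ le_aN).
under eq_bigr => b _ do rewrite mibin_addS natrD !mulrDl.
rewrite big_split /= addrC; congr (_ + _); last first.
  apply: eq_bigr => b _; have [le_ba|/forallPn[j]] := boolP (mile (mi_of b) a).
    by rewrite /ddelta miadd_subAC.
  by rewrite -ltnNge => /mibin_eq0->; rewrite !mul0r.
rewrite -(@sum_box_shift _ _ N (fun b => (mibin a b)%:R * ddelta i f b * g (misub a b)) i).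
  apply: eq_bigr => b _; rewrite mi_ofE; case: ifP => b_gt0; last by rewrite !mul0r.
  have le_ib : mile (mie i 1) (mi_of b) by rewrite mile_mie mi_ofE.
  rewrite /ddelta misubK //; congr (_ * g _).
  by rewrite -{1}(misubK le_ib) misubDr.
by move=> b /(leq_trans (lt_aN i)) /mibin_eq0->; rewrite !mul0r.
Qed.

Lemma dmulDl f g h : dmul (dadd f g) h = dadd (dmul f h) (dmul g h).
Proof.
apply/funext => a; rewrite /dadd /dmul -big_split /=.
by apply: eq_bigr => b _; rewrite mulrDr mulrDl.
Qed.

Lemma dmulZl c f g : dmul (dscale c f) g = dscale c (dmul f g).
Proof.
apply/funext => a; rewrite /dscale /dmul big_distrr /=.
by apply: eq_bigr => b _; rewrite !mulrA [_ * c]mulrC.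
Qed.

(* A function is determined by its value at [mi0] and its images under the [ddelta i]: hence
   commutativity and associativity follow from the Leibniz rule by induction on the index. *)
Lemma dmulC f g : dmul f g = dmul g f.
Proof.
apply/funext => a; elim/mi_ind: a f g => [|a i IHa] f g; first by rewrite !dmul_mi0 mulrC.
rewrite -[LHS]/(ddelta i (dmul f g) a) -[RHS]/(ddelta i (dmul g f) a) !ddelta_dmul.
by rewrite /dadd addrC; congr (_ + _).
Qed.

Lemma dmulDr f g h : dmul f (dadd g h) = dadd (dmul f g) (dmul f h).
Proof. by rewrite dmulC dmulDl !(dmulC f). Qed.

Lemma dmulA f g h : dmul f (dmul g h) = dmul (dmul f g) h.
Proof.
apply/funext => a; elim/mi_ind: a f g h => [|a i IHa] f g h; first by rewrite !dmul_mi0 mulrA.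
rewrite -[LHS]/(ddelta i (dmul f (dmul g h)) a) -[RHS]/(ddelta i (dmul (dmul f g) h) a).
by rewrite !ddelta_dmul dmulDr dmulDl /dadd !IHa addrA.
Qed.

Lemma ddelta_done i : ddelta i (@done K n) = dscale 0 (@done K n).
Proof.
apply/funext => a; rewrite /ddelta /dscale mul0r /done /dbasis; case: eqP => // /ffunP/(_ i).
by rewrite !miE eqxx addn1.
Qed.

Lemma dmul1 f : dmul (@done K n) f = f.
Proof.
apply/funext => a; elim/mi_ind: a f => [|a i IHa] f.
  by rewrite dmul_mi0 /done /dbasis eqxx mul1r.
rewrite -[LHS]/(ddelta i (dmul _ f) a) ddelta_dmul ddelta_done dmulZl /dadd IHa.
by rewrite /dscale mul0r add0r.
Qed.

End Product.

(* The operations of D_n make sense on all coefficient functions, which form an algebra in which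
   the finitely supported ones are a subalgebra. *)
Section Algebra.
Variables (K : fieldType) (n : nat).
Implicit Types f g : Dfun K n.

HB.instance Definition _ := gen_eqMixin (Dfun K n).
HB.instance Definition _ := gen_choiceMixin (Dfun K n).

Let daddA : associative (@dadd K n).
Proof. by move=> f g h; apply/funext => a; rewrite /dadd addrA. Qed.
Let daddC : commutative (@dadd K n).
Proof. by move=> f g; apply/funext => a; rewrite /dadd addrC. Qed.
Let dadd0 : left_id (fun=> 0) (@dadd K n).
Proof. by move=> f; apply/funext => a; rewrite /dadd add0r. Qed.
Let daddN : left_inverse (fun=> 0) (fun f a => - f a) (@dadd K n).
Proof. by move=> f; apply/funext => a; rewrite /dadd addNr. Qed.

HB.instance Definition _ := GRing.isZmodule.Build (Dfun K n) daddA daddC dadd0 daddN.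

Let done_neq0 : (@done K n) != 0.
Proof.
apply/eqP => /(congr1 (fun f => f (mi0 n)))/eqP.
by rewrite /done /dbasis eqxx oner_eq0.
Qed.

HB.instance Definition _ := GRing.Zmodule_isComNzRing.Build (Dfun K n)
  (@dmulA K n) (@dmulC K n) (@dmul1 K n) (@dmulDl K n) done_neq0.

Let dscaleA c d f : dscale c (dscale d f) = dscale (c * d) f.
Proof. by apply/funext => a; rewrite /dscale mulrA. Qed.
Let dscale1 : left_id 1 (@dscale K n).
Proof. by move=> f; apply/funext => a; rewrite /dscale mul1r. Qed.
Let dscaleDr : right_distributive (@dscale K n) (@dadd K n).
Proof. by move=> c f g; apply/funext => a; rewrite /dscale /dadd mulrDr. Qed.
Let dscaleDl f : {morph (@dscale K n)^~ f : c d / c + d >-> dadd c d}.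
Proof. by move=> c d; apply/funext => a; rewrite /dscale /dadd mulrDl. Qed.

HB.instance Definition _ :=
  GRing.Zmodule_isLmodule.Build K (Dfun K n) dscaleA dscale1 dscaleDr dscaleDl.

Let dscaleAl (c : K) f g : c *: (f * g) = (c *: f) * g.
Proof. exact/esym/dmulZl. Qed.

HB.instance Definition _ := GRing.Lmodule_isLalgebra.Build K (Dfun K n) dscaleAl.
HB.instance Definition _ := GRing.Lalgebra_isComAlgebra.Build K (Dfun K n).

Lemma Dfun1E a : (1 : Dfun K n) a = (a == mi0 n)%:R. Proof. by []. Qed.
Lemma DfunDE f g a : (f + g) a = f a + g a. Proof. by []. Qed.
Lemma DfunNE f a : (- f) a = - f a. Proof. by []. Qed.
Lemma DfunZE (c : K) f a : (c *: f) a = c * f a. Proof. by []. Qed.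

Definition DfunE := (Dfun1E, DfunDE, DfunNE, DfunZE).

Lemma ddivpowE f m : ddivpow f m = divpow m f.
Proof.
rewrite /ddivpow /divpow; congr (_ *: _).
by elim: m => [//|m IHm]; rewrite exprS -IHm.
Qed.

Fact ddelta_is_linear i : linear (@ddelta K n i).
Proof. by []. Qed.

HB.instance Definition _ i :=
  GRing.isLinear.Build K (Dfun K n) (Dfun K n) *:%R (ddelta i) (ddelta_is_linear i).

Fact dint_is_linear i : linear (@dint K n i).
Proof.
move=> c f g; apply/funext => a; rewrite DfunE DfunZE /dint.
by case: ifP => // _; rewrite mulr0 addr0.
Qed.

HB.instance Definition _ i :=
  GRing.isLinear.Build K (Dfun K n) (Dfun K n) *:%R (dint i) (dint_is_linear i).

Lemma ddelta_derivation i : derivation (@ddelta K n i).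
Proof. exact: ddelta_dmul. Qed.

End Algebra.

Section Operators.
Variables (K : fieldType) (n : nat).
Implicit Types (f g : Dfun K n) (a b c : mi n) (i j : 'I_n).

Lemma iter_ddeltaE m i f a : iter m (ddelta i) f a = f (miadd a (mie i m)).
Proof.
elim: m a => [|m IHm] a /=; first by rewrite mie0 miadd0.
by rewrite /ddelta IHm -miaddA mie_add.
Qed.

Lemma iter_dintE m i f a :
  iter m (dint i) f a = if (m <= a i)%N then f (misub a (mie i m)) else 0.
Proof.
elim: m a => [|m IHm] a /=; first by rewrite mie0 misub0.
rewrite /dint IHm -misubDA mie_add add1n !miE eqxx subn1.
by case: (a i).
Qed.

Lemma iter_ddelta_dintK m i f : iter m (ddelta i) (iter m (dint i) f) = f.
Proof. by apply/funext => a; rewrite iter_ddeltaE iter_dintE !miE eqxx leq_addl miaddK. Qed.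

Lemma iter_ddelta_dintC m i j f : j != i ->
  iter m (ddelta j) (iter m (dint i) f) = iter m (dint i) (iter m (ddelta j) f).
Proof.
move=> neq_ji; apply/funext => a; rewrite iter_ddeltaE !iter_dintE iter_ddeltaE.
rewrite !miE eq_sym (negPf neq_ji) addn0; case: leqP => // le_ma.
by rewrite miadd_subAC ?mile_mie.
Qed.

Lemma iter_dint1 m i : iter m (dint i) 1 = dbasis K (mie i m).
Proof.
apply/funext => a; rewrite iter_dintE DfunE /dbasis -mile_mie.
have [le_ma|notle_ma] := boolP (mile (mie i m) a); last first.
  by case: eqP notle_ma => // ->; rewrite mile_mie miE eqxx leqnn.
congr (_ %:R); congr nat_of_bool; apply/eqP/eqP => [sub0|->]; last by rewrite mie_sub subnn mie0.
by rewrite -(misubK le_ma) sub0 -(mie0 i) mie_add.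
Qed.

Lemma iter_ddelta_eq0 m i f :
  iter m (ddelta i) f = 0 <-> forall a, f a != 0 -> (a i < m)%N.
Proof.
split=> [Df0 a|supp_f]; last first.
  apply/funext => a; rewrite iter_ddeltaE; apply/eqP/contraT => /supp_f.
  by rewrite !miE eqxx ltnNge leq_addl.
rewrite ltnNge -mile_mie; apply: contraNN => le_ma.
by rewrite -(misubK le_ma) -iter_ddeltaE Df0.
Qed.

Lemma ddeltaPE q a f c : ddeltaP q a f c = f [ffun j => (c j + a j * q)%N].
Proof.
rewrite /ddeltaP; set r := enum 'I_n.
have -> : [ffun j => (c j + a j * q)%N] =
          [ffun j => (c j + (if j \in r then a j * q else 0))%N].
  by apply/ffunP => j; rewrite !ffunE mem_enum.
elim: r (enum_uniq 'I_n : uniq r) c => [_|i r IHr /= /andP[/negPf notin_r uniq_r]] c /=.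
  by congr (f _); apply/ffunP => j; rewrite ffunE addn0.
rewrite -iterM iter_ddeltaE IHr //; congr (f _); apply/ffunP => j; rewrite !ffunE in_cons.
by case: (j =P i) => [->|_]; rewrite ?notin_r ?addn0.
Qed.

Lemma ddeltaP0 q f : ddeltaP q (mi0 n) f = f.
Proof.
apply/funext => c; rewrite ddeltaPE; congr (f _).
by apply/ffunP => j; rewrite ffunE miE addn0.
Qed.

Lemma ddeltaP_addS q a i f :
  ddeltaP q (miadd a (mie i 1)) f = ddeltaP q a (iter q (ddelta i) f).
Proof.
apply/funext => c; rewrite !ddeltaPE iter_ddeltaE; congr (f _).
by apply/ffunP => j; rewrite !ffunE mulnDl addnA; case: eqP; rewrite ?mul1n.
Qed.

Lemma ddeltaP_mie q i f : ddeltaP q (mie i 1) f = iter q (ddelta i) f.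
Proof. by rewrite -[1%N]add0n -mie_add mie0 ddeltaP_addS ddeltaP0. Qed.

Lemma ddeltaP_family q (y : mi n -> Dfun K n) :
  (forall i b, iter q (ddelta i) (y b) = if (0 < b i)%N then y (misub b (mie i 1)) else 0) ->
  forall a b, ddeltaP q a (y b) = if mile a b then y (misub b a) else 0.
Proof.
move=> Dy; elim/mi_ind => [|a i IHa] b; first by rewrite ddeltaP0 mile0 misub0.
rewrite ddeltaP_addS Dy; case: ifP => [b_gt0|/negbT b_eq0].
  by rewrite IHa mile_sub_mie // -misubDA [miadd (mie i 1) a]miaddC.
have -> : mile (miadd a (mie i 1)) b = false.
  apply: contraNF b_eq0 => /forallP/(_ i); rewrite !miE eqxx addn1; exact: leq_trans.
by apply/funext => c; rewrite ddeltaPE.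
Qed.

Lemma Dfun_mi0M f g : (f * g) (mi0 n) = f (mi0 n) * g (mi0 n).
Proof. exact: dmul_mi0. Qed.

Lemma Dfun_mi0X f m : (f ^+ m) (mi0 n) = f (mi0 n) ^+ m.
Proof.
elim: m => [|m IHm]; last by rewrite !exprS Dfun_mi0M IHm.
by rewrite !expr0 DfunE eqxx.
Qed.

Lemma eq_from_ddelta f g :
  f (mi0 n) = g (mi0 n) -> (forall i, ddelta i f = ddelta i g) -> f = g.
Proof.
move=> eq0 eqD; apply/funext; elim/mi_ind => [//|a i _].
by rewrite -[LHS]/(ddelta i f a) eqD.
Qed.

(* Every [ddelta i] kills a p-th power, which is therefore a constant. *)
Lemma Dfun_expp p f : p \in [pchar K] -> f ^+ p = (f (mi0 n) ^+ p)%:A.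
Proof.
move=> pcharKp; have p_gt0 := prime_gt0 (pcharf_prime pcharKp).
apply: eq_from_ddelta => [|i]; first by rewrite Dfun_mi0X !DfunE eqxx mulr1.
rewrite linearZ /= (derivation1 (ddelta_derivation i)) scaler0.
rewrite -(prednK p_gt0) (derivationX _ _ (ddelta_derivation i)) prednK //.
by rewrite -scaler_nat (pcharf0 pcharKp) scale0r.
Qed.

Lemma Dfun_expp_eq0 p f : p \in [pchar K] -> (f ^+ p == 0) = (f (mi0 n) == 0).
Proof.
move=> pcharKp; rewrite Dfun_expp // scaler_eq0 oner_eq0 orbF.
by rewrite expf_eq0 prime_gt0 ?(pcharf_prime pcharKp).
Qed.

End Operators.

Section FiniteSupport.
Variables (K : fieldType) (n : nat).
Implicit Types f g : Dfun K n.

Lemma inD1 : inD (1 : Dfun K n).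
Proof. by exists 1%N => a; rewrite DfunE; case: (a =P mi0 n) => [-> _ j|_]; rewrite ?miE ?eqxx. Qed.

Lemma inD_add f g : inD f -> inD g -> inD (f + g).
Proof.
move=> [N fN] [M gM]; exists (N + M)%N => a; rewrite DfunE => nz j.
have [f0|/fN/(_ j) lt_a] := eqVneq (f a) 0; last exact: ltn_addr.
by apply/ltn_addl/gM; move: nz; rewrite f0 add0r.
Qed.

Lemma inD_mul f g : inD f -> inD g -> inD (f * g).
Proof.
move=> [N fN] [M gM]; exists (N + M)%N => a nz j.
rewrite ltnNge; apply: contraNN nz => le_a.
rewrite -[(f * g) a]/(dmul f g a) /dmul big1 // => b /forallP le_ba.
have [le_Nb|lt_bN] := leqP N (b j).
  have /eqP-> : f [ffun j => (b j : nat)] == 0.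
    by apply: contraTT le_Nb => /fN/(_ j); rewrite ffunE -ltnNge.
  by rewrite mulr0 mul0r.
have /eqP-> : g [ffun j => (a j - b j)%N] == 0; last by rewrite mulr0.
apply: contraTT le_a => /gM/(_ j); rewrite ffunE -ltnNge ltn_subLR // => lt_a.
by rewrite (ltn_trans lt_a) // ltn_add2r.
Qed.

Lemma inD_scale (c : K) f : inD f -> inD (c *: f).
Proof.
move=> [N fN]; exists N => a; rewrite DfunZE => nz.
by apply: fN; apply: contraNneq nz => ->; rewrite mulr0.
Qed.

Lemma inD_prod I (r : seq I) (F : I -> Dfun K n) :
  (forall i, inD (F i)) -> inD (\prod_(i <- r) F i).
Proof. by move=> DF; apply: (big_ind (@inD K n)); [exact: inD1 | exact: inD_mul |]. Qed.

Lemma inD_divpow m f : inD f -> inD (divpow m f).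
Proof.
move=> Df; apply: inD_scale; elim: m => [|m IHm]; first exact: inD1.
by rewrite exprS; apply: inD_mul.
Qed.

Lemma inD_iter_dint m i f : inD f -> inD (iter m (dint i) f).
Proof.
move=> [N fN]; exists (N + m)%N => a; rewrite iter_dintE; case: leqP => [le_ma nz j|].
  have := fN _ nz j; rewrite !miE; case: eqP => [->|_]; first by rewrite ltn_subLR // addnC.
  by rewrite subn0 => /ltn_addr.
by rewrite eqxx.
Qed.

End FiniteSupport.

(** * Families of divided powers for the iterated derivations *)

Section IteratedDerivations.
Variables (K : fieldType) (p n s : nat).
Hypothesis pcharKp : p \in [pchar K].
Implicit Types (i j : 'I_n) (u : 'I_n -> nat -> Dfun K n) (z : mi n -> Dfun K n).
Local Notation q := (p ^ s)%N.
Local Notation Delta i := (iter q (@ddelta K n i)).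
Local Notation Int i := (iter q (@dint K n i)).

Let p_pr : prime p := pcharf_prime pcharKp.
Let p_gt0 : (0 < p)%N := prime_gt0 p_pr.
Let p_gt1 : (1 < p)%N := prime_gt1 p_pr.

Lemma derivation_iter_ddelta i : derivation (Delta i).
Proof.
apply: derivation_iter_pexp (ddelta_derivation i).
by rewrite pchar_lalg.
Qed.

Lemma inMnsP u :
  inMns p s u <-> forall i k, u i k (mi0 n) = 0 /\ forall j, Delta j (u i k) = 0.
Proof.
split=> [Mu i k|Mu i k].
  have [_ supp_u] := Mu i k; split=> [|j].
    by apply/eqP/contraT => /supp_u[]; rewrite eqxx.
  by apply/iter_ddelta_eq0 => a /supp_u[_].
have [u0 Du] := Mu i k; have supp_u j : forall a, u i k a != 0 -> (a j < q)%N.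
  exact/iter_ddelta_eq0.
split=> [|a nz]; first by exists q => a nz j; apply: supp_u nz.
by split=> [|j]; [apply: contraNneq nz => ->; rewrite u0 | apply: supp_u nz].
Qed.

Lemma inIDP z :
  inID p s z <-> [/\ forall a, inD (z a), divpow_family z &
    forall i a, Delta i (z a) = if (0 < a i)%N then z (misub a (mie i 1)) else 0].
Proof.
split=> [[Dz z0 zM zD]|[Dz [z0 zM] zD]]; split=> //; last exact: ddeltaP_family.
by move=> i a; rewrite -ddeltaP_mie zD mile_mie.
Qed.

Lemma uzE z i k : uz p s z i k = z (mie i (p ^ k)) - Int i (z (mie i (p ^ k).-1)).
Proof. by []. Qed.

Section Recursion.
Variable u : 'I_n -> nat -> Dfun K n.
Local Notation y i := (ypk p s u i).

Lemma ypkE i k : y i k = u i k + Int i (digit_divpow p (y i) (p ^ k).-1).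
Proof.
have prodE m : (yP p s u i m).2 = \prod_(l < m.+1) divpow p.-1 (y i l).
  elim: m => [|m IHm]; first by rewrite big_ord1 -ddivpowE.
  by rewrite big_ord_recr -IHm -ddivpowE.
rewrite digit_divpow_predn //; case: k => [|k]; last by rewrite -prodE.
by rewrite big_ord0 iter_dint1 addrC.
Qed.

Lemma yjE i m : yj p s u i m = digit_divpow p (y i) m.
Proof. by apply: eq_bigr => k _; rewrite ddivpowE. Qed.

Lemma yuE a : yu p s u a = \prod_i digit_divpow p (y i) (a i).
Proof. by apply: eq_bigr => i _; apply: yjE. Qed.

Lemma yu_mie i m : yu p s u (mie i m) = digit_divpow p (y i) m.
Proof.
rewrite yuE (bigD1 i) //= mieE eqxx big1 ?mulr1 // => j /negPf neq_ji.
by rewrite mieE neq_ji digit_divpow0.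
Qed.

Lemma yuK : uz p s (yu p s u) = u.
Proof.
apply/funext => i; apply/funext => k; rewrite uzE !yu_mie digit_divpow_pexp // ypkE.
by rewrite addrK.
Qed.

Hypothesis Mu : inMns p s u.

Let u_mi0 i k : u i k (mi0 n) = 0.
Proof. by have /inMnsP/(_ i k)[] := Mu. Qed.

Let Delta_u i j k : Delta j (u i k) = 0.
Proof. by have /inMnsP/(_ i k)[_] := Mu. Qed.

Lemma ypk_nilp i k : y i k ^+ p = 0.
Proof.
apply/eqP; rewrite Dfun_expp_eq0 // ypkE DfunE u_mi0 iter_dintE miE leqNgt expn_gt0 p_gt0.
by rewrite addr0.
Qed.

Lemma iter_ddelta_ypk i k : Delta i (y i k) = digit_divpow p (y i) (p ^ k).-1.
Proof. by rewrite ypkE raddfD /= Delta_u add0r iter_ddelta_dintK. Qed.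

Lemma iter_ddelta_ypk_neq i j k : j != i -> Delta j (y i k) = 0.
Proof.
move=> neq_ji; elim/ltn_ind: k => k IHk; rewrite ypkE raddfD /= Delta_u add0r.
rewrite iter_ddelta_dintC // digit_divpow_predn //.
rewrite (derivation_prod_eq0 (derivation_iter_ddelta j)) ?raddf0 // => l _.
exact/(derivation_divpow_eq0 _ (derivation_iter_ddelta j))/IHk.
Qed.

Lemma iter_ddelta_digit_divpow i j m : Delta j (digit_divpow p (y i) m) =
  if (j == i) && (0 < m)%N then digit_divpow p (y i) m.-1 else 0.
Proof.
have [->|neq_ji] := eqVneq j i; last first.
  apply: (derivation_prod_eq0 (derivation_iter_ddelta j)) => k _.
  exact/(derivation_divpow_eq0 _ (derivation_iter_ddelta j))/iter_ddelta_ypk_neq.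
rewrite (derivation_digit_divpow pcharKp (w := 1) _ (derivation_iter_ddelta i)) ?mul1r //.
  exact: ypk_nilp.
by move=> k; rewrite mul1r; apply: iter_ddelta_ypk.
Qed.

Lemma iter_ddelta_yu i a :
  Delta i (yu p s u a) = if (0 < a i)%N then yu p s u (misub a (mie i 1)) else 0.
Proof.
rewrite yuE (bigD1 i) //= derivation_iter_ddelta iter_ddelta_digit_divpow eqxx /=.
rewrite (derivation_prod_eq0 (derivation_iter_ddelta i)) => [|j neq_ji]; last first.
  by rewrite /= iter_ddelta_digit_divpow eq_sym (negPf neq_ji).
rewrite mulr0 addr0; case: ifP => _; last by rewrite mul0r.
rewrite yuE [RHS](bigD1 i) //= !miE eqxx subn1; congr (_ * _).
by apply: eq_bigr => j /negPf neq_ji; rewrite !miE neq_ji subn0.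
Qed.

Lemma inD_yu a : inD (yu p s u a).
Proof.
have inD_y i k : inD (y i k).
  elim/ltn_ind: k => k IHk; rewrite ypkE digit_divpow_predn //.
  apply: inD_add; first by case: (Mu i k).
  by apply/inD_iter_dint/inD_prod => l; apply/inD_divpow/IHk.
by rewrite yuE; apply: inD_prod => i; apply: inD_prod => k; apply: inD_divpow.
Qed.

Lemma inID_yu : inID p s (yu p s u).
Proof.
apply/inIDP; split; [exact: inD_yu | | exact: iter_ddelta_yu].
have -> : yu p s u = fun a => \prod_i digit_divpow p (y i) (a i) by apply/funext/yuE.
apply: (@divpow_family_prod _ _ _ (fun i => digit_divpow p (y i))) => i.
by apply: (digit_divpow_seq pcharKp) => k; apply: ypk_nilp.
Qed.

End Recursion.

Section Inverse.
Variable z : mi n -> Dfun K n.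
Hypothesis IDz : inID p s z.

Let z_family : divpow_family z. Proof. by have /inIDP[] := IDz. Qed.
Let z_seq i : divpow_seq (fun m => z (mie i m)) := divpow_family_mie i z_family.

Lemma inID_ddelta_mie i j m :
  Delta j (z (mie i m)) = if (j == i) && (0 < m)%N then z (mie i m.-1) else 0.
Proof.
have /inIDP[_ _ ->] := IDz; rewrite mieE; case: eqP => [->|_] //=.
by rewrite mie_sub subn1.
Qed.

Lemma inMns_uz : inMns p s (uz p s z).
Proof.
apply/inMnsP => i k; have q_gt0 : (0 < q)%N by rewrite expn_gt0 p_gt0.
split=> [|j].
  rewrite uzE DfunDE DfunNE iter_dintE miE leqNgt q_gt0 subr0.
  by apply/eqP; rewrite -(Dfun_expp_eq0 _ pcharKp) (divpow_seq_pexp_nilp pcharKp k (z_seq i)).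
rewrite uzE raddfB /= inID_ddelta_mie expn_gt0 p_gt0 andbT.
have [->|neq_ji] := eqVneq j i; first by rewrite iter_ddelta_dintK subrr.
by rewrite iter_ddelta_dintC // inID_ddelta_mie (negPf neq_ji) raddf0 subrr.
Qed.

Lemma ypk_uz i k : ypk p s (uz p s z) i k = z (mie i (p ^ k)).
Proof.
elim/ltn_ind: k => k IHk; rewrite ypkE uzE.
have -> : digit_divpow p (ypk p s (uz p s z) i) (p ^ k).-1 = z (mie i (p ^ k).-1).
  rewrite -[RHS](digit_divpowK pcharKp (z_seq i)) !digit_divpow_predn //.
  by apply: eq_bigr => l _; rewrite IHk.
by rewrite subrK.
Qed.

Lemma uzK : yu p s (uz p s z) = z.
Proof.
apply/funext => a; rewrite (divpow_familyE a z_family) yuE; apply: eq_bigr => i _.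
rewrite -[RHS](digit_divpowK pcharKp (z_seq i)).
by apply: eq_digit_divpow => k; apply: ypk_uz.
Qed.

End Inverse.
End IteratedDerivations.

Theorem theorem5p1 (K : fieldType) (p : nat) (n s : nat) :
  p \in [pchar K] -> (1 <= s)%N ->
  (forall u : 'I_n -> nat -> Dfun K n, inMns p s u -> inID p s (yu p s u)) /\
  (forall z : mi n -> Dfun K n, inID p s z -> inMns p s (uz p s z) /\ yu p s (uz p s z) = z) /\
  (forall u : 'I_n -> nat -> Dfun K n, inMns p s u -> uz p s (yu p s u) = u).
Proof.
move=> pcharKp _; split; first by move=> u; apply: inID_yu.
by split=> [z IDz|u _]; [split; [apply: inMns_uz | apply: uzK] | apply: yuK].
Qed.
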